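(* Let $T$ be a power bounded operator on a complex Banach space, let $w\in A^{1,1}(\mathbb D)$, $w(z)=\sum_{k\ge0}c_kz^k$, and suppose that $\sup_{n\ge1}\|w(T^n)\|\le q<\|w\|_\infty$. Let $$E=E(w,q):=\Big\{\lambda\in\mathbb T:\ \sup_{n\ge1}|w(\lambda^n)|\le q\Big\}$$ (a finite set of roots of unity), suppose that $E\neq\emptyset$, and put $M=M(T)$, $L_w=\sum_{k\ge1}k|c_k|$ and $D=\max_{\xi\in E}\operatorname{ord}(\xi)$. Choose a closed arc $\Gamma\subset\mathbb T$ of angular length $\ell>0$ and a number $a>q$ such that $\min_{\eta\in\Gamma}|w(\eta)|\ge a$. Let $U$ be the union of the open angular neighbourhoods of radius $\ell/(2D)$ about the points of $E$, and set $F_0=\mathbb T\setminus U$. If $F_0\ne\emptyset$, there exists $N\ge1$ such that $$g:=\min_{\eta\in F_0}\max_{1\le n\le N}|w(\eta^n)|-q>0 .$$ For any such $N$ and $g$, $$K_E(T)\le M+(1+M)ML_w\max\Big\{\frac{2\pi}{a-q},\frac{2N}{g}\Big\}.$$ When $F_0=\emptyset$, the same bound holds with the second term in the maximum omitted.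
   Context: $\mathbb D$ is the open unit disc, $\mathbb T$ the unit circle. $M(T):=\sup_{n\ge0}\|T^n\|$; $T$ is power bounded if $M(T)<\infty$. $A^{1,1}(\mathbb D)$ is the algebra of functions $w(z)=\sum_{k\ge0}c_kz^k$ with $\sum_k(k+1)|c_k|<\infty$; $\|w\|_\infty:=\max_{\mathbb T}|w|$; $w(S):=\sum_{k\ge0}c_kS^k$ for power bounded $S$. $\operatorname{ord}(\xi)$ is the order of a root of unity $\xi$. Angular distance on $\mathbb T$ takes values in $[0,\pi]$. For a finite nonempty $E\subset\mathbb T$, $K_E(T):=\sup_{|\lambda|>1}\operatorname{dist}(\lambda,E)\,\|(\lambda-T)^{-1}\|$. *)

(* Defs.v *)
From Stdlib Require Import Reals List.
From Coquelicot Require Import Coquelicot.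

Open Scope R_scope.

(** A complex Banach space is a [CompleteNormedModule C_AbsRing]; a bounded
    linear operator on it is a map satisfying [is_linear] (which includes
    boundedness). *)

Definition is_max (P : R -> Prop) (m : R) : Prop :=
  P m /\ forall r, P r -> r <= m.

Definition is_min (P : R -> Prop) (m : R) : Prop :=
  P m /\ forall r, P r -> m <= r.

(** Sum of a convergent series; unspecified when the series diverges. *)
Definition vsum {V : CompleteNormedModule C_AbsRing} (a : nat -> V) : V :=
  iota (is_series a).

Definition oppow {V : CompleteNormedModule C_AbsRing}
  (T : V -> V) (n : nat) : V -> V :=
  fun x => Nat.iter n T x.

Definition opnorm {V : CompleteNormedModule C_AbsRing} (S : V -> V) : Rbar :=
  Lub_Rbar (fun r => exists x : V, norm x <= 1 /\ r = norm (S x)).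

Definition power_sup {V : CompleteNormedModule C_AbsRing} (T : V -> V) : Rbar :=
  Sup_seq (fun n => opnorm (oppow T n)).

Definition power_bounded {V : CompleteNormedModule C_AbsRing}
  (T : V -> V) : Prop :=
  Rbar_lt (power_sup T) p_infty.

(** Functions in [A^{1,1}] are represented by their Taylor coefficients. *)
Definition in_A11 (c : nat -> C) : Prop :=
  ex_series (fun k => (INR k + 1) * Cmod (c k)).

Definition weval (c : nat -> C) (z : C) : C :=
  vsum (V := C_CompleteNormedModule) (fun k => (c k * Cpow z k)%C).

(** For a power bounded [S] the series [sum_k c_k S^k] converges absolutely in
    operator norm, so its sum is the operator given by the pointwise sums. *)
Definition wop {V : CompleteNormedModule C_AbsRing}
  (c : nat -> C) (S : V -> V) : V -> V :=
  fun x => vsum (fun k => scal (c k : C_AbsRing) (oppow S k x)).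

Definition on_circle (z : C) : Prop := Cmod z = 1.

Definition wsup (c : nat -> C) : Rbar :=
  Lub_Rbar (fun r => exists z, on_circle z /\ r = Cmod (weval c z)).

Definition Lw (c : nat -> C) : R := Series (fun k => INR k * Cmod (c k)).

Definition Ewq (c : nat -> C) (q : R) (z : C) : Prop :=
  on_circle z /\
  Rbar_le (Sup_seq (fun n => Finite (Cmod (weval c (Cpow z (S n)))))) q.

Definition has_order (z : C) (n : nat) : Prop :=
  (1 <= n)%nat /\ Cpow z n = RtoC 1 /\
  forall m, (1 <= m)%nat -> Cpow z m = RtoC 1 -> (n <= m)%nat.

Definition is_max_order (E : C -> Prop) (D : R) : Prop :=
  is_max (fun r => exists z n, E z /\ has_order z n /\ r = INR n) D.

Definition finite_set (E : C -> Prop) : Prop :=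
  exists s : list C, forall z, E z -> In z s.

Definition dist_set (z : C) (E : C -> Prop) : Rbar :=
  Glb_Rbar (fun r => exists xi, E xi /\ r = Cmod (z - xi)%C).

Definition is_resolvent {V : CompleteNormedModule C_AbsRing}
  (T : V -> V) (z : C) (S : V -> V) : Prop :=
  let A := fun x : V => minus (scal (z : C_AbsRing) x) (T x) in
  is_linear S /\ (forall x, S (A x) = x) /\ (forall x, A (S x) = x).

(** The infimum is over at most one value: this is the norm of [(z - T)^{-1}],
    and [p_infty] if [z - T] is not invertible. *)
Definition resolvent_norm {V : CompleteNormedModule C_AbsRing}
  (T : V -> V) (z : C) : Rbar :=
  Rbar_glb (fun r => exists S, is_resolvent T z S /\ r = opnorm S).

Definition KE {V : CompleteNormedModule C_AbsRing}
  (E : C -> Prop) (T : V -> V) : Rbar :=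
  Rbar_lub (fun r => exists z, 1 < Cmod z /\
    r = Rbar_mult (dist_set z E) (resolvent_norm T z)).

(** Angle in [[0, PI]] between two points of the unit circle. *)
Definition angdist (z xi : C) : R := acos (Re (z * Cconj xi)%C).

(** The closed arc of angular length [l] starting at [exp (i t0)]. *)
Definition arc (t0 l : R) (z : C) : Prop :=
  exists t, t0 <= t <= t0 + l /\ z = (cos t, sin t).

Definition ang_nbhd (E : C -> Prop) (rho : R) (z : C) : Prop :=
  on_circle z /\ exists xi, E xi /\ angdist z xi < rho.

Definition F0 (E : C -> Prop) (rho : R) (z : C) : Prop :=
  on_circle z /\ ~ ang_nbhd E rho z.

(** [g = min_{z in F} max_{1 <= n <= N} |w(z^n)| - q]. *)
Definition is_gap (c : nat -> C) (q : R) (F : C -> Prop) (N : nat) (g : R)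
  : Prop :=
  is_min (fun r => exists z, F z /\
            is_max (fun s => exists n, (1 <= n <= N)%nat /\
                      s = Cmod (weval c (Cpow z n))) r)
         (g + q).

(* Main.v *)
Require Import Defs.
From Stdlib Require Import Reals Lra Lia List ZArith.
From Stdlib Require Import Classical ClassicalEpsilon ssreflect.
From Coquelicot Require Import Coquelicot.

Open Scope R_scope.

(** The powers [T^m] and [eta^m] differ on a vector [x] by at most
    [m M |(eta - T) x|], since the difference telescopes. Summing against the
    coefficients [c_k], a vector [x] satisfies
    [|w(T^n) x - w(eta^n) x| <= n M L_w |(eta - T) x|], and as
    [|w(T^n)| <= q] this yields the basic inequality

      [(|w(eta^n)| - q) |x| <= n M L_w |(eta - T) x|]      for [|eta| = 1]

    ([lower_bound_of_wop]). It bounds [eta - T] from below whenever some power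
    of [eta] lies where [|w| > q], at a cost proportional to the exponent.

    For [eta] in [F_0] an exponent [n <= N] with [|w(eta^n)| >= q + g] exists
    by definition of the gap [g]. For [eta] at angle [th < l / (2 D)] from a
    point [xi] of [E] of order [d <= D], the numbers [eta^(d n)] are at angle
    [d n th] from [1]. Their steps are shorter than the arc [Gamma], so they
    meet it before completing a turn, at an exponent [m = d n] with
    [m th <= 2 PI]; the factor [th], which dominates [|eta - xi|], compensates
    the size of [m] ([lower_bound_near_E]). In both cases
    [|eta - xi| |x| <= K |(eta - T) x|] for some [xi] in [E], with [K] equal to
    [M L_w] times the maximum in the theorem.

    This passes from the circle to [|z| > 1] by comparing [z] with
    [eta = z / |z|]: the Neumann series gives
    [|(z - T)^-1| <= M / (|z| - 1)], hence [|(eta - T) (z - T)^-1| <= 1 + M]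
    ([KE_le_of_circle_bound]).

    That [E] consists of finitely many roots of unity comes from the same
    marching argument: [|w| > q] on some arc, by Dirichlet's theorem every
    [z] on the circle has a power [z^d] with [d] bounded and [z^d] within half
    the length of that arc from [1], and if [z] is in [E] this forces
    [z^d = 1] ([Ewq_order_bound]). The existence of the gap is a compactness
    statement: each point of [F_0] has a power where [|w| > q], and [F_0] is
    compact ([gap_exists]). *)

(** * Series in normed modules *)

Lemma norm_series_le {K : AbsRing} {V : NormedModule K}
  (a : nat -> V) (b : nat -> R) (l : V) (m : R) :
  is_series a l -> is_series b m -> (forall n, norm (a n) <= b n) ->
  norm l <= m.
Proof.
  intros Ha Hb Hab.
  assert (Hn : forall n, norm (sum_n a n) <= sum_n b n).
  { induction n as [|n IH].
    - rewrite !sum_O; apply Hab.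
    - rewrite !sum_Sn.
      eapply Rle_trans; [apply norm_triangle|].
      apply Rplus_le_compat; [exact IH | apply Hab]. }
  assert (H : Rbar_le (norm l) m); [|exact H].
  apply (filterlim_le (F := eventually) (fun n => norm (sum_n a n)) (sum_n b)).
  - exists 0%nat; intros n _; apply Hn.
  - apply (filterlim_comp _ _ _ (sum_n a) norm eventually (locally l)).
    + exact Ha.
    + apply filterlim_norm.
  - exact Hb.
Qed.

Lemma series_sum_unique {K : AbsRing} {V : NormedModule K}
  (a : nat -> V) (l1 l2 : V) :
  is_series a l1 -> is_series a l2 -> l1 = l2.
Proof. apply filterlim_locally_unique. Qed.

Lemma vsum_unique {V : CompleteNormedModule C_AbsRing} (a : nat -> V) (l : V) :
  is_series a l -> vsum a = l.
Proof. intros H; unfold vsum; apply (iota_filterlim_locally _ _ H). Qed.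

Lemma vsum_correct {V : CompleteNormedModule C_AbsRing} (a : nat -> V) :
  ex_series a -> is_series a (vsum a).
Proof. intros [l Hl]; rewrite (vsum_unique a l Hl); exact Hl. Qed.

Lemma is_series_linear {K : AbsRing} {U V : NormedModule K}
  (S : U -> V) (a : nat -> U) (l : U) :
  is_linear S -> is_series a l -> is_series (fun k => S (a k)) (S l).
Proof.
  intros HS Ha.
  apply (filterlim_ext (fun n => S (sum_n a n))).
  - induction x as [|n IH].
    + now rewrite !sum_O.
    + rewrite !sum_Sn -IH. apply (linear_plus _ HS).
  - apply (filterlim_comp _ _ _ (sum_n a) S eventually (locally l)).
    + exact Ha.
    + apply (linear_cont S l HS).
Qed.

(** [z |-> scal z x] is a bounded linear map from [C] to [V], so the statement
    is an instance of the previous one. *)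
Lemma is_series_scal_r {V : NormedModule C_AbsRing}
  (a : nat -> C) (l : C) (x : V) :
  is_series (V := C_NormedModule) a l ->
  is_series (fun k => scal (a k : C_AbsRing) x) (scal (l : C_AbsRing) x).
Proof.
  apply (is_series_linear (fun z : C_NormedModule => scal (z : C_AbsRing) x)).
  split.
  - intros y z; exact (scal_distr_r (y : C_AbsRing) (z : C_AbsRing) x).
  - intros k y; exact (eq_sym (scal_assoc (k : C_AbsRing) (y : C_AbsRing) x)).
  - exists (norm x + 1); assert (0 <= norm x) by apply norm_ge_0; split; [lra|].
    intros y; eapply Rle_trans; [apply (norm_scal (K := C_AbsRing))|].
    change (abs (y : C_AbsRing)) with (Cmod y); change (norm y) with (Cmod y).
    assert (0 <= Cmod y) by apply Cmod_ge_0; nra.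
Qed.

Lemma Sup_seq_ub (u : nat -> Rbar) (n : nat) : Rbar_le (u n) (Sup_seq u).
Proof.
  rewrite Rbar_sup_eq_lub.
  apply (proj2_sig (Rbar_ex_lub (fun r => exists k, r = u k))).
  now exists n.
Qed.

(** * Linear maps, their iterates and the operator norm *)

Lemma minus_plus_r {G : AbelianGroup} (a b : G) : minus (plus a b) b = a.
Proof. by rewrite /minus -plus_assoc plus_opp_r plus_zero_r. Qed.

Lemma minus_plus_l {G : AbelianGroup} (a b : G) : minus (plus a b) a = b.
Proof. by rewrite plus_comm minus_plus_r. Qed.

Lemma minus_minus_minus {G : AbelianGroup} (a b d : G) :
  minus (minus a b) (minus a d) = minus d b.
Proof. by rewrite (minus_trans d a b) minus_plus_l. Qed.

Section LinearMaps.
Context {W : NormedModule C_AbsRing}.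
Implicit Types (S : W -> W) (x y : W).

Lemma norm_scal_C (z : C) x : norm (scal (z : C_AbsRing) x) <= Cmod z * norm x.
Proof. exact (norm_scal (z : C_AbsRing) x). Qed.

Lemma scal_C_inv (z : C) x : z <> 0%C ->
  scal ((/ z)%C : C_AbsRing) (scal (z : C_AbsRing) x) = x.
Proof.
  intros Hz; rewrite scal_assoc.
  replace (mult ((/ z)%C : C_AbsRing) z) with (one : C_AbsRing).
  - apply scal_one.
  - symmetry; apply (Cinv_l z Hz).
Qed.

(** Over a field the axiom [norm (scal z x) <= abs z * norm x] of normed
    modules is an equality, by applying it to [/ z] as well. *)
Lemma norm_scal_C_eq (z : C) x : norm (scal (z : C_AbsRing) x) = Cmod z * norm x.
Proof.
  apply Rle_antisym; [apply norm_scal_C|].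
  destruct (Ceq_dec z 0) as [->|Hz].
  - rewrite Cmod_0 Rmult_0_l; apply norm_ge_0.
  - rewrite -{1}(scal_C_inv z x Hz).
    assert (H := norm_scal_C (/ z) (scal (z : C_AbsRing) x)).
    assert (H0 := proj1 (Cmod_gt_0 z) Hz).
    rewrite (Cmod_inv z Hz) in H.
    apply (Rmult_le_compat_l (Cmod z)) in H; [|lra].
    rewrite -Rmult_assoc Rinv_r in H; lra.
Qed.

Lemma normalize x : norm x <> 0 ->
  exists u : W, norm u = 1 /\ x = scal (RtoC (norm x) : C_AbsRing) u.
Proof.
  intros Hx.
  assert (Hz : RtoC (norm x) <> 0%C) by now intros E; apply Hx, RtoC_inj.
  assert (Hz' : (/ RtoC (norm x))%C <> 0%C).
  { intros E; apply C1_nz; rewrite -(Cinv_l _ Hz) E; ring. }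
  exists (scal ((/ RtoC (norm x))%C : C_AbsRing) x); split.
  - rewrite norm_scal_C_eq (Cmod_inv _ Hz) Cmod_R Rabs_pos_eq;
      last by apply norm_ge_0.
    now field.
  - rewrite -{1}(scal_C_inv _ x Hz').
    f_equal; field; exact Hz.
Qed.

Lemma linear_bound_of_ball S (m : R) x :
  is_linear S -> (forall u, norm u <= 1 -> norm (S u) <= m) ->
  norm (S x) <= m * norm x.
Proof.
  intros HS Hm.
  destruct (Req_dec (norm x) 0) as [H0|H0].
  - rewrite (norm_eq_zero x H0) (linear_zero S HS) norm_zero; lra.
  - destruct (normalize x H0) as (u & Hu & E).
    specialize (Hm u (Req_le _ _ Hu)).
    rewrite {1}E (linear_scal _ HS).
    eapply Rle_trans; [apply norm_scal_C|].
    rewrite Cmod_R Rabs_pos_eq; last by apply norm_ge_0.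
    assert (0 <= norm x) by apply norm_ge_0; nra.
Qed.

Lemma is_linear_iter S n : is_linear S -> is_linear (Nat.iter n S).
Proof.
  intros HS; induction n as [|n IH].
  - apply is_linear_id.
  - apply (is_linear_comp (Nat.iter n S) S IH HS).
Qed.

(** Telescoping: each of the [m] factors of [eta] traded for [S] costs one
    power of [S], hence one factor [M]. *)
Lemma iter_scal_diff S (M : R) (eta : C) x m :
  is_linear S -> (forall n y, norm (Nat.iter n S y) <= M * norm y) ->
  Cmod eta = 1 ->
  norm (minus (Nat.iter m S x) (scal (Cpow eta m : C_AbsRing) x))
    <= INR m * M * norm (minus (S x) (scal (eta : C_AbsRing) x)).
Proof.
  intros HS HM Heta; induction m as [|m IH].
  - assert (E : scal (Cpow eta 0 : C_AbsRing) x = x) by exact (scal_one x).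
    simpl Nat.iter; rewrite E.
    replace (minus x x) with (zero : W) by exact (eq_sym (minus_eq_zero x)).
    rewrite norm_zero; simpl; lra.
  - set (d := minus (S x) (scal (eta : C_AbsRing) x)) in *.
    set (e := minus (Nat.iter m S x) (scal (Cpow eta m : C_AbsRing) x)) in *.
    assert (Hm := is_linear_iter S m HS).
    assert (E : minus (Nat.iter (Datatypes.S m) S x)
                  (scal (Cpow eta (Datatypes.S m) : C_AbsRing) x)
                = plus (Nat.iter m S d) (scal (eta : C_AbsRing) e)).
    { unfold d, e.
      rewrite (minus_trans (scal (eta : C_AbsRing) (Nat.iter m S x))).
      rewrite (linear_minus _ _ _ Hm) (linear_scal _ Hm) scal_minus_distr_l
        scal_assoc Nat.iter_succ_r.
      reflexivity. }
    rewrite E; eapply Rle_trans; [apply norm_triangle|].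
    rewrite S_INR.
    assert (H1 := HM m d).
    assert (H2 := norm_scal_C eta e); rewrite Heta in H2.
    lra.
Qed.

Lemma iter_mul S n k x : Nat.iter k (Nat.iter n S) x = Nat.iter (n * k) S x.
Proof.
  induction k as [|k IH].
  - now rewrite Nat.mul_0_r.
  - rewrite Nat.mul_succ_r Nat.add_comm Nat.iter_add -IH; reflexivity.
Qed.

End LinearMaps.

Section OperatorNorm.
Context {V : CompleteNormedModule C_AbsRing}.
Implicit Types (S T : V -> V) (x y : V).

Lemma opnorm_ge0 S : is_linear S -> Rbar_le 0 (opnorm S).
Proof.
  intros HS; unfold opnorm.
  destruct (Lub_Rbar_correct
    (fun r => exists x : V, norm x <= 1 /\ r = norm (S x))) as [H _].
  apply H; exists zero; split.
  - apply Rle_trans with 0; [exact (Req_le _ _ norm_zero) | lra].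
  - transitivity (norm (zero : V)).
    + symmetry; exact norm_zero.
    + f_equal; symmetry; exact (linear_zero S HS).
Qed.

Lemma opnorm_le S (m : R) : 0 <= m -> (forall x, norm (S x) <= m * norm x) ->
  Rbar_le (opnorm S) m.
Proof.
  intros Hm H; unfold opnorm; apply Lub_Rbar_correct.
  intros r (x & Hx & ->); simpl.
  specialize (H x); nra.
Qed.

Lemma opnorm_bound_ball S (m : R) x :
  Rbar_le (opnorm S) m -> norm x <= 1 -> norm (S x) <= m.
Proof.
  intros H Hx.
  assert (G : Rbar_le (norm (S x)) m); [|exact G].
  eapply Rbar_le_trans; [|exact H].
  apply Lub_Rbar_correct; now exists x.
Qed.

Lemma opnorm_bound S (m : R) x :
  is_linear S -> Rbar_le (opnorm S) m -> norm (S x) <= m * norm x.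
Proof.
  intros HS Hm; apply linear_bound_of_ball; [exact HS|].
  intros u; now apply opnorm_bound_ball.
Qed.

Lemma power_sup_finite T : is_linear T -> power_bounded T ->
  0 <= real (power_sup T) /\
  forall n x, norm (oppow T n x) <= real (power_sup T) * norm x.
Proof.
  intros HT Hpb; unfold power_bounded in Hpb.
  assert (Hle : forall n, Rbar_le (opnorm (oppow T n)) (power_sup T))
    by (intros n; exact (Sup_seq_ub (fun k => opnorm (oppow T k)) n)).
  assert (H0 := Rbar_le_trans _ _ _
    (opnorm_ge0 _ (is_linear_iter T 0 HT)) (Hle 0%nat)).
  destruct (power_sup T) as [M| |]; try easy.
  split; [exact H0|].
  intros n x; apply opnorm_bound; [now apply (is_linear_iter T) | apply Hle].
Qed.

End OperatorNorm.

(** * The calculus of [A^{1,1}] *)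

Lemma ex_series_A11 (c : nat -> C) : in_A11 c ->
  ex_series (fun k => Cmod (c k)) /\ ex_series (fun k => INR k * Cmod (c k)).
Proof.
  intros Hc; split; apply (ex_series_le (V := R_CompleteNormedModule)) with (2 := Hc);
    intros n; assert (0 <= INR n) by apply pos_INR;
    assert (0 <= Cmod (c n)) by apply Cmod_ge_0;
    apply Rabs_le; nra.
Qed.

Lemma Lw_ge0 (c : nat -> C) : in_A11 c -> 0 <= Lw c.
Proof.
  intros Hc; apply ex_series_A11, proj2 in Hc.
  unfold Lw; apply Rle_trans with (Series (fun k => 0 * (INR k * Cmod (c k)))).
  - rewrite Series_scal_l; lra.
  - apply Series_le; [|exact Hc].
    intros n; assert (0 <= INR n * Cmod (c n)); [|lra].
    apply Rmult_le_pos; [apply pos_INR | apply Cmod_ge_0].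
Qed.

Lemma is_series_weval (c : nat -> C) (z : C) : in_A11 c -> Cmod z <= 1 ->
  is_series (V := C_NormedModule) (fun k => (c k * Cpow z k)%C) (weval c z).
Proof.
  intros Hc Hz.
  apply (vsum_correct (V := C_CompleteNormedModule)).
  apply (ex_series_le (V := C_CompleteNormedModule))
    with (2 := proj1 (ex_series_A11 c Hc)).
  intros n; change norm with Cmod; rewrite Cmod_mult Cmod_pow.
  assert (0 <= Cmod (c n)) by apply Cmod_ge_0.
  assert (Cmod z ^ n <= 1).
  { rewrite -(pow1 n); apply pow_incr; split; [apply Cmod_ge_0 | exact Hz]. }
  nra.
Qed.

Lemma is_series_wop {V : CompleteNormedModule C_AbsRing} (c : nat -> C)
  (S : V -> V) (M : R) (x : V) :
  in_A11 c -> (forall n y, norm (oppow S n y) <= M * norm y) ->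
  is_series (fun k => scal (c k : C_AbsRing) (oppow S k x)) (wop c S x).
Proof.
  intros Hc HM; unfold wop.
  apply vsum_correct.
  apply (ex_series_le (V := V) _ (fun k => M * norm x * Cmod (c k))).
  - intros n; eapply Rle_trans; [apply (norm_scal_C (W := V))|].
    specialize (HM n x); assert (0 <= Cmod (c n)) by apply Cmod_ge_0; nra.
  - apply (ex_series_scal_l (V := R_NormedModule) (M * norm x)).
    apply (ex_series_A11 c Hc).
Qed.

Lemma wop_weval_diff {V : CompleteNormedModule C_AbsRing} (c : nat -> C)
  (T : V -> V) (M : R) (eta : C) (n : nat) (x : V) :
  in_A11 c -> is_linear T -> (forall n y, norm (oppow T n y) <= M * norm y) ->
  Cmod eta = 1 ->
  norm (minus (wop c (oppow T n) x) (scal (weval c (Cpow eta n) : C_AbsRing) x))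
    <= INR n * M * Lw c * norm (minus (T x) (scal (eta : C_AbsRing) x)).
Proof.
  intros Hc HT HM Heta.
  set (d := norm (minus (T x) (scal (eta : C_AbsRing) x))).
  assert (HMn : forall k y, norm (oppow (oppow T n) k y) <= M * norm y)
    by (intros k y; unfold oppow; rewrite (iter_mul T); apply HM).
  assert (Hw := is_series_wop c (oppow T n) M x Hc HMn).
  assert (He : Cmod (Cpow eta n) <= 1) by (rewrite Cmod_pow Heta pow1; lra).
  assert (Hs := is_series_scal_r (V := V) _ _ x (is_series_weval c _ Hc He)).
  assert (HL : is_series (fun k => INR n * M * d * (INR k * Cmod (c k)))
                 (INR n * M * d * Lw c)).
  { apply (is_series_scal_l (V := R_NormedModule) (INR n * M * d)).
    apply Series_correct.
    apply (ex_series_A11 c Hc). }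
  replace (INR n * M * Lw c * d) with (INR n * M * d * Lw c) by ring.
  refine (norm_series_le _ _ _ _ (is_series_minus _ _ _ _ Hw Hs) HL _).
  intros k; cbv beta.
  change (c k * Cpow (Cpow eta n) k)%C
    with (mult (c k : C_AbsRing) (Cpow (Cpow eta n) k)).
  rewrite -scal_assoc.
  change (plus ?u (opp ?v)) with (minus u v).
  rewrite -scal_minus_distr_l; unfold oppow; rewrite (iter_mul T) -Cpow_mult_r.
  eapply Rle_trans; [apply (norm_scal_C (W := V))|].
  assert (H := iter_scal_diff T M eta x (n * k) HT HM Heta).
  rewrite mult_INR in H.
  eapply Rle_trans.
  - apply Rmult_le_compat_l; [apply Cmod_ge_0 | exact H].
  - right.
    change (Cmod (c k) * (INR n * INR k * M * d)
            = INR n * M * d * (INR k * Cmod (c k))).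
    ring.
Qed.

(** This is [wop_weval_diff] for the operator of multiplication by [zeta] on
    the space [C], applied to the vector [1]. *)
Lemma weval_lipschitz (c : nat -> C) (eta zeta : C) :
  in_A11 c -> Cmod eta = 1 -> Cmod zeta = 1 ->
  Cmod (weval c zeta - weval c eta)%C <= Lw c * Cmod (zeta - eta)%C.
Proof.
  intros Hc He Hz.
  set (S := fun z : C_CompleteNormedModule => scal (zeta : C_AbsRing) z).
  assert (HS : is_linear S).
  { exact (is_linear_scal_r (V := C_NormedModule) (zeta : C_AbsRing) Cmult_comm). }
  assert (Hp : forall n (y : C), oppow S n y = (Cpow zeta n * y)%C :> C).
  { induction n as [|n IH]; intros y.
    - exact (eq_sym (Cmult_1_l y)).
    - change (oppow S (Datatypes.S n) y) with (zeta * oppow S n y)%C.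
      rewrite IH Cpow_S; ring. }
  assert (HM : forall n y, norm (oppow S n y) <= 1 * norm y).
  { intros n y; rewrite Hp; change norm with Cmod.
    rewrite Cmod_mult Cmod_pow Hz pow1; lra. }
  assert (H := wop_weval_diff c S 1 eta 1 (RtoC 1) Hc HS HM He).
  assert (E : wop c (oppow S 1) (RtoC 1) = weval c zeta).
  { apply vsum_unique.
    apply (is_series_ext (fun k => (c k * Cpow zeta k)%C)).
    - intros n; unfold oppow; rewrite (iter_mul S) Nat.mul_1_l.
      change (c n * Cpow zeta n = c n * oppow S n (RtoC 1))%C.
      rewrite Hp; ring.
    - apply is_series_weval; [exact Hc | lra]. }
  rewrite E in H.
  change (Cmod (weval c zeta - weval c (Cpow eta 1) * 1)%C
    <= 1 * 1 * Lw c * Cmod (zeta * 1 - eta * 1)%C) in H.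
  rewrite Cpow_1_r !Cmult_1_r in H; lra.
Qed.

(** Comparing [w(T^n)x] with [w(eta^n)x]: a vector that [eta - T] almost kills
    is almost an eigenvector of [w(T^n)] for [w(eta^n)], which is impossible
    when [|w(eta^n)|] exceeds the norm of [w(T^n)]. *)
Lemma lower_bound_of_wop {V : CompleteNormedModule C_AbsRing} (c : nat -> C)
  (T : V -> V) (M q : R) (eta : C) (n : nat) (x : V) :
  in_A11 c -> is_linear T -> 0 <= M -> (forall n y, norm (oppow T n y) <= M * norm y) ->
  Rbar_le (opnorm (wop c (oppow T n))) q ->
  Cmod eta = 1 ->
  (Cmod (weval c (Cpow eta n)) - q) * norm x
    <= INR n * M * Lw c * norm (minus (T x) (scal (eta : C_AbsRing) x)).
Proof.
  intros Hc HT HM0 HM Hq Heta.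
  set (w := weval c (Cpow eta n)).
  set (A := fun y : V => minus (T y) (scal (eta : C_AbsRing) y)).
  destruct (Req_dec (norm x) 0) as [H0|H0].
  - apply Rle_trans with 0; [rewrite H0; lra|].
    assert (0 <= INR n) by apply pos_INR.
    assert (0 <= Lw c) by now apply Lw_ge0.
    assert (0 <= norm (A x)) by exact (norm_ge_0 (V := V) _).
    repeat apply Rmult_le_pos; assumption.
  - destruct (normalize (W := V) x H0) as (u & Hu & E).
    assert (HA : A x = scal (RtoC (norm x) : C_AbsRing) (A u)).
    { unfold A; rewrite {1 2}E (linear_scal _ HT) scal_minus_distr_l !scal_assoc.
      f_equal; f_equal; apply Cmult_comm. }
    set (v := wop c (oppow T n) u).
    set (wu := scal (w : C_AbsRing) u).
    assert (H1 : norm (minus v wu) <= INR n * M * Lw c * norm (A u))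
      by exact (wop_weval_diff c T M eta n u Hc HT HM Heta).
    assert (H2 : norm v <= q) by exact (opnorm_bound_ball _ _ u Hq (Req_le _ _ Hu)).
    assert (H3 : Rabs (norm v - norm wu) <= norm (minus v wu))
      by exact (norm_triangle_inv v wu).
    assert (H4 : norm wu = Cmod w * 1)
      by (rewrite -Hu; exact (norm_scal_C_eq (W := V) w u)).
    apply Rabs_le_between in H3.
    assert (HAn : norm (A x) = norm x * norm (A u)).
    { rewrite HA (norm_scal_C_eq (W := V)) Cmod_R Rabs_pos_eq //.
      exact (norm_ge_0 (V := V) x). }
    fold (A x); rewrite HAn.
    assert (0 <= norm x) by exact (norm_ge_0 (V := V) x).
    assert (H5 : Cmod w - q <= INR n * M * Lw c * norm (A u)) by lra.
    apply (Rmult_le_compat_r (norm x)) in H5; lra.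
Qed.

(** * The resolvent outside the disc *)

(** The Neumann series [sum_k z^-(k+1) T^k]. *)
Lemma resolvent_exists {V : CompleteNormedModule C_AbsRing} (T : V -> V)
  (M : R) (z : C) :
  is_linear T -> (forall n y, norm (oppow T n y) <= M * norm y) -> 0 <= M ->
  1 < Cmod z ->
  exists S, is_resolvent T z S /\ forall x, norm (S x) <= M / (Cmod z - 1) * norm x.
Proof.
  intros HT HM HM0 Hz.
  assert (Hz0 : z <> 0%C) by (intros E; rewrite E Cmod_0 in Hz; lra).
  set (b := fun (x : V) k => scal (Cpow (/ z)%C (S k) : C_AbsRing) (oppow T k x)).
  assert (HTk : forall k, is_linear (oppow T k))
    by (intros k; exact (is_linear_iter T k HT)).
  assert (Hgeo : is_series (fun k => (/ Cmod z) ^ S k) (/ (Cmod z - 1))).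
  { assert (Hi : 0 < / Cmod z < 1).
    { split; [apply Rinv_0_lt_compat; lra|].
      rewrite -Rinv_1; apply Rinv_lt_contravar; lra. }
    replace (/ (Cmod z - 1)) with (/ Cmod z * / (1 - / Cmod z)) by (field; lra).
    apply (is_series_scal_l (V := R_NormedModule)), is_series_geom.
    rewrite Rabs_pos_eq; lra. }
  assert (Hb : forall x k, norm (b x k) <= M * norm x * (/ Cmod z) ^ S k).
  { intros x k; unfold b; rewrite (norm_scal_C_eq (W := V)) Cmod_pow Cmod_inv //.
    assert (0 <= (/ Cmod z) ^ S k).
    { apply pow_le, Rlt_le, Rinv_0_lt_compat; lra. }
    specialize (HM k x); nra. }
  assert (HB : forall x : V, is_series (fun k => M * norm x * (/ Cmod z) ^ S k)
                          (M * norm x * / (Cmod z - 1))).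
  { intros x; now apply (is_series_scal_l (V := R_NormedModule)). }
  set (Rz := fun x : V => vsum (b x)).
  assert (HR : forall x : V, is_series (b x) (Rz x)).
  { intros x; apply vsum_correct.
    apply (ex_series_le (V := V)) with (1 := Hb x).
    eexists; apply HB. }
  assert (HRn : forall x : V, norm (Rz x) <= M / (Cmod z - 1) * norm x).
  { intros x; assert (H := norm_series_le _ _ _ _ (HR x) (HB x) (Hb x)).
    eapply Rle_trans; [exact H|]. right; field; lra. }
  assert (HRp : forall x y : V, Rz (plus x y) = plus (Rz x) (Rz y)).
  { intros x y; apply vsum_unique.
    apply (is_series_ext (fun k => plus (b x k) (b y k))).
    - intros k; unfold b.
      rewrite (linear_plus _ (HTk k)) scal_distr_l //.
    - now apply (is_series_plus (V := V)). }
  assert (HRs : forall (a : C) (x : V),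
    Rz (scal (a : C_AbsRing) x) = scal (a : C_AbsRing) (Rz x)).
  { intros a x; apply vsum_unique.
    apply (is_series_ext (fun k => scal (a : C_AbsRing) (b x k))).
    - intros k; unfold b.
      rewrite (linear_scal _ (HTk k)) !scal_assoc.
      f_equal; apply Cmult_comm.
    - now apply (is_series_scal_l (V := V)). }
  assert (HRT : forall x : V, Rz (T x) = T (Rz x)).
  { intros x; apply vsum_unique.
    apply (is_series_ext (fun k => T (b x k))).
    - intros k; unfold b.
      rewrite (linear_scal _ HT); f_equal.
      exact (Nat.iter_succ_r k _ T x).
    - now apply (is_series_linear (U := V) (V := V)). }
  (* Multiplying the Neumann series by [z] shifts it by one term. *)
  assert (HzR : forall x : V, scal (z : C_AbsRing) (Rz x) = plus x (T (Rz x))).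
  { intros x.
    assert (H1 := is_series_scal_l (V := V) (z : C_AbsRing) _ _ (HR x)).
    refine (series_sum_unique (V := V) _ _ _ H1 _).
    apply (is_series_decr_1 (V := V)).
    assert (E0 : scal (z : C_AbsRing) (b x 0%nat) = x).
    { unfold b; rewrite scal_assoc.
      replace (mult (z : C_AbsRing) (Cpow (/ z) 1)) with (one : C_AbsRing).
      - exact (scal_one x).
      - rewrite Cpow_1_r; exact (eq_sym (Cinv_r z Hz0)). }
    rewrite E0.
    assert (E1 : plus (plus x (T (Rz x))) (opp x) = T (Rz x))
      by exact (minus_plus_l x (T (Rz x))).
    rewrite E1.
    apply (is_series_ext (fun k => T (b x k))).
    - intros k; unfold b; rewrite (linear_scal _ HT) scal_assoc.
      f_equal.
      change (Cpow (/ z) (S k) = z * Cpow (/ z) (S (S k)))%C.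
      rewrite (Cpow_S _ (S k)) Cmult_assoc (Cinv_r z Hz0); ring.
    - now apply (is_series_linear (U := V) (V := V)). }
  assert (HRL : is_linear Rz).
  { split; [exact HRp | exact HRs |].
    exists (M / (Cmod z - 1) + 1); split.
    - assert (0 <= M / (Cmod z - 1)); [|lra].
      apply Rdiv_le_0_compat; lra.
    - intros x; eapply Rle_trans; [exact (HRn x)|].
      apply Rmult_le_compat_r; [apply norm_ge_0 | lra]. }
  exists Rz; split; [|exact HRn].
  split; [exact HRL | split]; intros x.
  - rewrite (linear_minus (U := V) (V := V) _ _ _ HRL) HRs HRT HzR.
    exact (minus_plus_r x (T (Rz x))).
  - rewrite HzR; exact (minus_plus_r x (T (Rz x))).
Qed.

(** * The circle and the powers of its points *)

Definition cis (t : R) : C := (cos t, sin t).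

Lemma cis_0 : cis 0 = RtoC 1.
Proof. by rewrite /cis cos_0 sin_0. Qed.

Lemma cis_add (a b : R) : cis (a + b) = (cis a * cis b)%C.
Proof. rewrite /cis cos_plus sin_plus; apply injective_projections; simpl; ring. Qed.

Lemma cis_pow (t : R) (n : nat) : Cpow (cis t) n = cis (INR n * t).
Proof.
  induction n as [|n IH].
  - by rewrite Rmult_0_l cis_0.
  - rewrite Cpow_S IH S_INR -cis_add; f_equal; ring.
Qed.

Lemma cis_period (t : R) (k : Z) : cis (t + 2 * PI * IZR k) = cis t.
Proof.
  assert (H : forall (n : nat) (u : R), cis (u + 2 * PI * INR n) = cis u).
  { intros n u; rewrite /cis.
    replace (u + 2 * PI * INR n) with (u + 2 * INR n * PI) by ring.
    by rewrite cos_period sin_period. }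
  destruct (Z_le_gt_dec 0 k) as [Hk|Hk].
  - rewrite -(Z2Nat.id k Hk) -INR_IZR_INZ; apply H.
  - rewrite -(H (Z.to_nat (- k)) (t + 2 * PI * IZR k)) INR_IZR_INZ Z2Nat.id; [|lia].
    rewrite opp_IZR; f_equal; ring.
Qed.

Lemma Cmod_cis (t : R) : Cmod (cis t) = 1.
Proof.
  rewrite /Cmod /cis /= -{3}sqrt_1; f_equal.
  assert (H := sin2_cos2 t); rewrite /Rsqr in H; lra.
Qed.

Lemma cis_sub_1_le (t : R) : Cmod (cis t - 1)%C <= Rabs t.
Proof.
  assert (H : Rabs (sin (t / 2)) <= Rabs (t / 2)).
  { assert (G : forall u, 0 <= u -> Rabs (sin u) <= u).
    { intros u [Hu|<-]; [|rewrite sin_0 Rabs_R0; lra].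
      apply Rabs_le; split.
      - destruct (Rle_dec u PI) as [Hp|Hp].
        + assert (0 <= sin u) by (apply sin_ge_0; lra); lra.
        + assert (H := SIN_bound u); assert (H2 := PI2_1); lra.
      - left; now apply sin_lt_x. }
    destruct (Rle_dec 0 (t / 2)) as [Ht|Ht].
    - rewrite (Rabs_pos_eq (t / 2)) //; now apply G.
    - rewrite -Rabs_Ropp -sin_neg (Rabs_left (t / 2)); [apply G|]; lra. }
  apply Rsqr_incr_0; [|apply Cmod_ge_0|apply Rabs_pos].
  rewrite -Rsqr_abs.
  assert (E : Rsqr (Cmod (cis t - 1)%C) = 4 * Rsqr (sin (t / 2))).
  { rewrite /Cmod Rsqr_sqrt; [|apply Rplus_le_le_0_compat; apply pow2_ge_0].
    rewrite /cis /=.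
    assert (E1 := cos_2a_sin (t / 2)).
    replace (2 * (t / 2)) with t in E1 by field.
    assert (E2 := sin2_cos2 t); rewrite /Rsqr in E2 |- *.
    nra. }
  rewrite E.
  apply Rsqr_le_abs_1 in H; rewrite /Rsqr in H |- *; lra.
Qed.

(** The real part determines a point of the circle up to conjugation; the sign
    [sg] says on which half of the circle it lies. *)
Lemma circle_polar (z : C) : Cmod z = 1 ->
  exists sg, (sg = 1 \/ sg = -1) /\ z = cis (sg * acos (Re z)).
Proof.
  intros Hz; destruct z as [x y].
  assert (H : x * x + y * y = 1).
  { assert (E := Cmod2_alt (x, y)); rewrite Hz /= in E; lra. }
  assert (Hx : -1 <= x <= 1) by nra.
  simpl; assert (Hs := sin_acos x Hx).
  assert (E : sqrt (1 - x²) = Rabs y).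
  { rewrite -sqrt_Rsqr_abs; f_equal; rewrite /Rsqr; lra. }
  rewrite E in Hs.
  destruct (Rle_dec 0 y) as [Hy|Hy].
  - exists 1; split; [now left|]; rewrite Rmult_1_l /cis (cos_acos x Hx) Hs.
    by rewrite Rabs_pos_eq.
  - exists (-1); split; [now right|]; rewrite -Ropp_mult_distr_l Rmult_1_l.
    rewrite /cis cos_neg sin_neg (cos_acos x Hx) Hs Rabs_left; [|lra].
    by rewrite Ropp_involutive.
Qed.

Lemma cis_eq_1 (t : R) : cis t = RtoC 1 -> exists k : Z, t = 2 * PI * IZR k.
Proof.
  intros H; injection H as Hc Hs.
  assert (E1 := cos_2a_sin (t / 2)).
  replace (2 * (t / 2)) with t in E1 by field.
  assert (E2 : sin (t / 2) = 0) by nra.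
  destruct (sin_eq_0_0 _ E2) as [k Hk]; exists k; lra.
Qed.

(** A step shorter than the arc cannot jump over it. The stronger assumption
    [s <= l / 2] is for an arc that ends just after angle [0], before the first
    multiple of [s]: it has to be met at the end of the turn, by the last
    multiple of [s] that does not exceed [2 PI]. *)
Lemma arc_hit (t0 l s : R) : 0 < l <= 2 * PI -> 0 < s <= l / 2 ->
  exists (n : nat) (k : Z), (1 <= n)%nat /\ INR n * s <= 2 * PI /\
    t0 <= INR n * s + 2 * PI * IZR k <= t0 + l.
Proof.
  intros Hl Hs; assert (HPI := PI_RGT_0).
  (* The last multiple of [s] before the end of the arc; when that end lies
     just after a multiple of [2 PI], the last one before [2 PI] instead. *)
  assert (Hfl : forall u, s <= u -> exists n : nat,
            (1 <= n)%nat /\ u - s < INR n * s <= u).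
  { intros u Hu.
    assert (Hus : u = u / s * s) by (field; lra).
    assert (H1 : 1 <= u / s) by (apply Rmult_le_reg_r with s; lra).
    destruct (nfloor_ex (u / s)) as [n Hn]; [lra|].
    exists n; split; [|split; nra].
    destruct n as [|n]; [simpl in Hn; lra | lia]. }
  destruct (floor_ex ((t0 + l) / (2 * PI))) as [k Hk].
  set (t1 := t0 + l - 2 * PI * IZR k).
  assert (Ht1 : 0 <= t1 < 2 * PI).
  { assert (E : t0 + l = (t0 + l) / (2 * PI) * (2 * PI)) by (field; lra).
    unfold t1; set (v := (t0 + l) / (2 * PI)) in *.
    assert (0 <= (v - IZR k) * (2 * PI)) by (apply Rmult_le_pos; lra).
    assert ((v - IZR k) * (2 * PI) < 1 * (2 * PI)) by (apply Rmult_lt_compat_r; lra).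
    split; lra. }
  destruct (Rle_dec s t1) as [H|H].
  - destruct (Hfl t1 H) as (n & Hn & Hn'); exists n, k.
    unfold t1 in *; split; [exact Hn | lra].
  - destruct (Hfl (2 * PI)) as (n & Hn & Hn'); [lra|].
    exists n, (k - 1)%Z; rewrite minus_IZR.
    unfold t1 in *; split; [exact Hn | lra].
Qed.

Lemma power_hits_arc (t0 l s sg : R) (z : C) :
  0 < l <= 2 * PI -> 0 < s <= l / 2 -> sg = 1 \/ sg = -1 ->
  z = cis (sg * s) ->
  exists n, (1 <= n)%nat /\ INR n * s <= 2 * PI /\ arc t0 l (Cpow z n).
Proof.
  intros Hl Hs [-> | ->] ->.
  - destruct (arc_hit t0 l s Hl Hs) as (n & k & Hn & Hns & Ht).
    exists n; split; [exact Hn | split; [exact Hns|]].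
    eexists; split; [exact Ht|].
    rewrite cis_pow Rmult_1_l -(cis_period (INR n * s) k); reflexivity.
  - destruct (arc_hit (- t0 - l) l s Hl Hs) as (n & k & Hn & Hns & Ht).
    exists n; split; [exact Hn | split; [exact Hns|]].
    exists (- (INR n * s) + 2 * PI * IZR (- k)); rewrite opp_IZR; split; [lra|].
    rewrite -opp_IZR cis_pow.
    replace (INR n * (-1 * s)) with (- (INR n * s)) by ring.
    symmetry; apply cis_period.
Qed.

(** Pigeonhole: two of the [m + 1] first multiples of [x] have fractional parts
    in the same one of [m] equal subintervals of [[0, 1)]. *)
Lemma dirichlet (x : R) (m : nat) : (1 <= m)%nat ->
  exists (d : nat) (k : Z), (1 <= d <= m)%nat /\
    Rabs (INR d * x - IZR k) <= / INR m.
Proof.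
  intros Hm.
  assert (Hm' : 0 < INR m) by (apply lt_0_INR; lia).
  set (fr := fun j : nat => frac_part (INR j * x)).
  assert (Hfr : forall j, 0 <= fr j < 1).
  { intros j; destruct (base_fp (INR j * x)); unfold fr; lra. }
  set (box := fun j : nat => Z.to_nat (Int_part (INR m * fr j))).
  assert (Hbox : forall j, INR (box j) <= INR m * fr j < INR (box j) + 1).
  { intros j; destruct (base_Int_part (INR m * fr j)) as [H1 H2].
    assert (0 <= INR m * fr j) by (apply Rmult_le_pos; [lra | apply Hfr]).
    assert (-1 < Int_part (INR m * fr j))%Z by (apply lt_IZR; lra).
    unfold box; rewrite INR_IZR_INZ Z2Nat.id; [lra|lia]. }
  destruct (classic (exists i j, (i < j <= m)%nat /\ box i = box j))
    as [(i & j & Hij & E)|Hno].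
  - exists (j - i)%nat, (Int_part (INR j * x) - Int_part (INR i * x))%Z.
    split; [lia|].
    rewrite minus_INR; [|lia]; rewrite minus_IZR.
    replace ((INR j - INR i) * x - _) with (fr j - fr i)
      by (unfold fr, frac_part; ring).
    assert (Hi := Hbox i); assert (Hj := Hbox j); rewrite -E in Hj.
    apply Rabs_le; split; apply Rmult_le_reg_l with (INR m); try exact Hm';
      rewrite ?Ropp_mult_distr_r_reverse Rinv_r; lra.
  - exfalso.
    assert (Hnd : NoDup (map box (seq 0 (S m)))).
    { apply NoDup_map_NoDup_ForallPairs; [|apply seq_NoDup].
      intros i j Hi Hj E; apply in_seq in Hi, Hj.
      destruct (Nat.lt_trichotomy i j) as [H|[H|H]]; [|exact H|]; exfalso;
        apply Hno; [exists i, j | exists j, i]; (split; [lia|congruence]). }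
    apply (NoDup_incl_length (l' := seq 0 m)) in Hnd.
    + rewrite length_map !length_seq in Hnd; lia.
    + intros b Hb; apply in_map_iff in Hb as (j & <- & _).
      apply in_seq; split; [lia|]; apply INR_lt.
      assert (H1 := Hbox j); assert (H2 := Hfr j); simpl; nra.
Qed.

(** * The exceptional set [E] *)

Lemma Sup_seq_le_const (u : nat -> Rbar) (q : R) :
  (forall n, Rbar_le (u n) q) -> Rbar_le (Sup_seq u) q.
Proof.
  intros H; rewrite Rbar_sup_eq_lub.
  apply (proj2_sig (Rbar_ex_lub (fun r => exists k, r = u k))).
  by intros r [n ->].
Qed.

Lemma Ewq_le (c : nat -> C) (q : R) (z : C) (n : nat) :
  Ewq c q z -> (1 <= n)%nat -> Cmod (weval c (Cpow z n)) <= q.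
Proof.
  intros [_ H] Hn; destruct n as [|n]; [lia|].
  exact (Rbar_le_trans _ _ _
    (Sup_seq_ub (fun n => Finite (Cmod (weval c (Cpow z (S n))))) n) H).
Qed.

Lemma not_Ewq (c : nat -> C) (q : R) (z : C) : on_circle z -> ~ Ewq c q z ->
  exists n, (1 <= n)%nat /\ q < Cmod (weval c (Cpow z n)).
Proof.
  intros Hz H; apply NNPP; intros Hno; apply H; split; [exact Hz|].
  apply Sup_seq_le_const; intros n; apply Rnot_lt_le; intros Hlt; apply Hno.
  exists (S n); split; [lia | exact Hlt].
Qed.

Lemma cis_lipschitz (s t : R) : Cmod (cis s - cis t)%C <= Rabs (s - t).
Proof.
  replace (cis s - cis t)%C with (cis t * (cis (s - t) - 1))%C.
  - rewrite Cmod_mult Cmod_cis Rmult_1_l; apply cis_sub_1_le.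
  - replace (cis s) with (cis (t + (s - t))) by (f_equal; ring).
    rewrite cis_add; ring.
Qed.

Lemma weval_cis_lipschitz (c : nat -> C) (s t : R) : in_A11 c ->
  Rabs (Cmod (weval c (cis s)) - Cmod (weval c (cis t))) <= Lw c * Rabs (s - t).
Proof.
  intros Hc.
  assert (H1 := weval_lipschitz c (cis t) (cis s) Hc (Cmod_cis t) (Cmod_cis s)).
  assert (H2 := cis_lipschitz s t); assert (H3 := Lw_ge0 c Hc).
  assert (H4 : Rabs (Cmod (weval c (cis s)) - Cmod (weval c (cis t)))
               <= Cmod (weval c (cis s) - weval c (cis t))%C)
    by exact (norm_triangle_inv (V := C_NormedModule) (weval c (cis s)) (weval c (cis t))).
  apply (Rmult_le_compat_l (Lw c)) in H2; lra.
Qed.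

Lemma circle_cis (z : C) : Cmod z = 1 -> exists t, - PI <= t <= PI /\ z = cis t.
Proof.
  intros Hz; destruct (circle_polar z Hz) as (sg & Hsg & E).
  exists (sg * acos (Re z)); split; [|exact E].
  assert (H := acos_bound (Re z)); destruct Hsg as [-> | ->]; lra.
Qed.

(** A point where [|w| > q] is the start of an arc where this persists, by the
    Lipschitz bound on [w]. *)
Lemma arc_above (c : nat -> C) (q : R) : in_A11 c -> Rbar_lt q (wsup c) ->
  exists t0 l a, 0 < l <= 2 * PI /\ q < a /\
    forall eta, arc t0 l eta -> a <= Cmod (weval c eta).
Proof.
  intros Hc Hq.
  destruct (classic (exists z, on_circle z /\ q < Cmod (weval c z)))
    as [(z & Hz & Hlt)|Hno].
  - destruct (circle_cis z Hz) as (t0 & _ & ->).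
    set (m := Cmod (weval c (cis t0))) in *.
    assert (HL := Lw_ge0 c Hc); assert (HPI := PI_RGT_0).
    set (l := Rmin (2 * PI) ((m - q) / 2 / (Lw c + 1))).
    assert (Hl : 0 < l) by (apply Rmin_glb_lt; [lra | apply Rdiv_lt_0_compat; lra]).
    assert (Hl' : Lw c * l <= (m - q) / 2).
    { assert (l <= (m - q) / 2 / (Lw c + 1)) by apply Rmin_r.
      apply Rle_trans with ((Lw c + 1) * l); [nra|].
      apply Rle_trans with ((Lw c + 1) * ((m - q) / 2 / (Lw c + 1))).
      - apply Rmult_le_compat_l; lra.
      - right; field; lra. }
    exists t0, l, ((m + q) / 2); split; [split; [exact Hl | apply Rmin_l] | split; [lra|]].
    intros eta (t & Ht & ->).
    assert (H := weval_cis_lipschitz c t t0 Hc).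
    rewrite (Rabs_pos_eq (t - t0)) in H; [|lra].
    apply Rabs_le_between in H; fold m in H.
    change (cos t, sin t) with (cis t).
    assert (Lw c * (t - t0) <= Lw c * l) by (apply Rmult_le_compat_l; lra).
    lra.
  - exfalso; apply (Rbar_lt_not_le _ _ Hq), Lub_Rbar_correct.
    intros r (z & Hz & ->); apply Rnot_lt_le; intros Hlt; apply Hno; now exists z.
Qed.

(** A power of a point of [E] close to [1] but different from it would have its
    own powers march around the circle in steps too short to jump over the
    arc. *)
Lemma Ewq_power_eq_1 (c : nat -> C) (q t0 l a s sg : R) (z : C) (d : nat) :
  0 < l <= 2 * PI -> q < a ->
  (forall eta, arc t0 l eta -> a <= Cmod (weval c eta)) ->
  Ewq c q z -> (1 <= d)%nat -> 0 <= s <= l / 2 -> sg = 1 \/ sg = -1 ->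
  Cpow z d = cis (sg * s) -> Cpow z d = RtoC 1.
Proof.
  intros Hl Ha Harc Hz Hd [[Hs0|<-] Hs] Hsg E.
  - exfalso.
    destruct (power_hits_arc t0 l s sg _ Hl (conj Hs0 Hs) Hsg E) as (n & Hn & _ & H).
    apply Harc in H; rewrite -Cpow_mult_r in H.
    assert (H' := Ewq_le c q z (d * n) Hz ltac:(nia)); lra.
  - by rewrite E Rmult_0_r cis_0.
Qed.

(** The bound on the exponents given by [dirichlet] must make [z^d] closer to
    [1] than half the length of the arc: any number
    of boxes above [4 PI / l] will do. *)
Lemma Ewq_order_bound (c : nat -> C) (q : R) : in_A11 c -> Rbar_lt q (wsup c) ->
  exists m, forall z, Ewq c q z -> exists d, (1 <= d <= m)%nat /\ Cpow z d = RtoC 1.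
Proof.
  intros Hc Hq.
  destruct (arc_above c q Hc Hq) as (t0 & l & a & Hl & Ha & Harc).
  assert (HPI := PI_RGT_0).
  destruct (nfloor_ex (4 * PI / l)) as [m Hm].
  { apply Rdiv_le_0_compat; lra. }
  exists (S m); intros z Hz.
  destruct (circle_cis z (proj1 Hz)) as (t & _ & E).
  destruct (dirichlet (t / (2 * PI)) (S m)) as (d & k & Hd & H); [lia|].
  exists d; split; [exact Hd|].
  set (u := INR d * t - 2 * PI * IZR k).
  assert (Hu : Rabs u <= l / 2).
  { replace u with (2 * PI * (INR d * (t / (2 * PI)) - IZR k)) by (unfold u; field; lra).
    rewrite Rabs_mult Rabs_pos_eq; [|lra].
    apply Rle_trans with (2 * PI * / INR (S m)); [apply Rmult_le_compat_l; lra|].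
    rewrite S_INR; assert (0 <= INR m) by apply pos_INR.
    apply Rmult_le_reg_r with ((INR m + 1) * / l).
    { apply Rmult_lt_0_compat; [lra | apply Rinv_0_lt_compat; lra]. }
    replace (2 * PI * / (INR m + 1) * ((INR m + 1) * / l)) with (4 * PI / l / 2) by (field; lra).
    replace (l / 2 * ((INR m + 1) * / l)) with ((INR m + 1) / 2) by (field; lra).
    lra. }
  assert (Ez : Cpow z d = cis u).
  { rewrite E cis_pow -(cis_period u k); f_equal; unfold u; ring. }
  destruct (Rle_dec 0 u) as [H0|H0].
  - apply (Ewq_power_eq_1 c q t0 l a u 1 z d); auto; try lia.
    + rewrite Rabs_pos_eq in Hu; lra.
    + by rewrite Rmult_1_l.
  - apply (Ewq_power_eq_1 c q t0 l a (- u) (-1) z d); auto; try lia.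
    + rewrite Rabs_left in Hu; lra.
    + by replace (-1 * - u) with u by ring.
Qed.

Lemma finite_roots_of_unity (m : nat) :
  finite_set (fun z => Cmod z = 1 /\ exists d, (1 <= d <= m)%nat /\ Cpow z d = RtoC 1).
Proof.
  (* The angle in [[- PI, PI]] is [2 PI k / d] with [|k| <= m]; [j] lists
     [k + m]. *)
  exists (flat_map (fun d => map (fun j => cis (2 * PI * (INR j - INR m) / INR d))
            (seq 0 (2 * m + 1))) (seq 1 m)).
  intros z (Hz & d & Hd & E).
  assert (HPI := PI_RGT_0).
  destruct (circle_cis z Hz) as (t & Ht & ->).
  rewrite cis_pow in E; destruct (cis_eq_1 _ E) as [k Hk].
  assert (Hd0 : 1 <= INR d) by (apply (le_INR 1); lia).
  assert (Hdm : INR d <= INR m) by (apply le_INR; lia).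
  assert (Hkb : (- Z.of_nat m <= k <= Z.of_nat m)%Z).
  { assert (- (PI * INR d) <= INR d * t <= PI * INR d) by nra.
    assert (PI * INR d <= PI * INR m) by nra.
    assert (Hkm : - INR m <= 2 * IZR k <= INR m)
      by (split; apply Rmult_le_reg_l with PI; lra).
    assert (Hm0 : 0 <= INR m) by lra.
    rewrite INR_IZR_INZ in Hkm, Hm0; split; apply le_IZR; rewrite ?opp_IZR; lra. }
  apply in_flat_map; exists d; split; [apply in_seq; lia|].
  apply in_map_iff; exists (Z.to_nat (k + Z.of_nat m)); split; [|apply in_seq; lia].
  f_equal.
  rewrite (INR_IZR_INZ (Z.to_nat _)) Z2Nat.id; [|lia].
  rewrite plus_IZR -INR_IZR_INZ.
  apply Rmult_eq_reg_l with (INR d); [|lra].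
  rewrite Hk; field; lra.
Qed.

Lemma has_order_exists (z : C) (d : nat) : (1 <= d)%nat -> Cpow z d = RtoC 1 ->
  exists n, has_order z n.
Proof.
  induction d as [d IH] using (well_founded_induction Nat.lt_wf_0); intros Hd E.
  destruct (classic (exists m, (1 <= m < d)%nat /\ Cpow z m = RtoC 1))
    as [(m & Hm & Em)|Hno].
  - apply (IH m); [lia | lia | exact Em].
  - exists d; split; [exact Hd | split; [exact E|]].
    intros m Hm Em; destruct (Nat.le_gt_cases d m) as [H|H]; [exact H|].
    exfalso; apply Hno; exists m; split; [lia | exact Em].
Qed.

(** * Existence of the gap *)

(** The maximum of [f 1, ..., f (n + 1)], a range that is never empty. *)
Fixpoint runmax (f : nat -> R) (n : nat) : R :=
  match n with
  | O => f 1%nat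
  | S n' => Rmax (runmax f n') (f (S n))
  end.

Lemma runmax_is_max (f : nat -> R) (n : nat) :
  is_max (fun s => exists k, (1 <= k <= S n)%nat /\ s = f k) (runmax f n).
Proof.
  induction n as [|n [(k & Hk & E) IH]].
  - split; [exists 1%nat; split; [lia | reflexivity]|].
    intros r (k & Hk & ->); replace k with 1%nat by lia; apply Rle_refl.
  - split.
    + simpl; destruct (Rmax_case_strong (runmax f n) (f (S (S n)))
        (fun m => m = runmax f n \/ m = f (S (S n)))) as [H|H]; auto; rewrite H.
      * exists k; split; [lia | exact E].
      * exists (S (S n)); split; [lia | reflexivity].
    + intros r (j & Hj & ->); simpl.
      destruct (Nat.eq_dec j (S (S n))) as [->|Hne]; [apply Rmax_r|].
      apply Rle_trans with (runmax f n); [apply IH; exists j; split; [lia|auto] | apply Rmax_l].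
Qed.

Lemma runmax_close (f g : nat -> R) (e : R) (n : nat) :
  (forall k, (1 <= k <= S n)%nat -> f k <= g k + e) -> runmax f n <= runmax g n + e.
Proof.
  intros H; destruct (runmax_is_max f n) as [(k & Hk & ->) _].
  apply Rle_trans with (g k + e); [now apply H|].
  apply Rplus_le_compat_r, (runmax_is_max g n); now exists k.
Qed.

(** Sequential compactness in the form used for the gap: when each [P n] is
    met in [K], one point of [K] is approached by solutions of [P m] with
    arbitrarily large [m]. *)
Lemma cluster_point (K : R -> Prop) (P : nat -> R -> Prop) :
  compact K -> (forall n, exists t, K t /\ P n t) ->
  exists x, K x /\ forall eps n, 0 < eps ->
    exists m t, (n <= m)%nat /\ K t /\ Rabs (t - x) < eps /\ P m t.
Proof.
  intros HK H.
  set (u := fun n => proj1_sig (constructive_indefinite_description _ (H n))).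
  assert (Hu : forall n, K (u n) /\ P n (u n))
    by (intros n; apply (proj2_sig (constructive_indefinite_description _ (H n)))).
  destruct (Bolzano_Weierstrass u K HK (fun n => proj1 (Hu n))) as [x Hx].
  assert (Hx' : forall eps n, 0 < eps ->
    exists m t, (n <= m)%nat /\ K t /\ Rabs (t - x) < eps /\ P m t).
  { intros eps n Heps.
    destruct (Hx (disc x (mkposreal eps Heps)) n) as (p & Hp & Hd).
    - exists (mkposreal eps Heps); intros y Hy; exact Hy.
    - exists p, (u p); split; [exact Hp | split; [apply Hu | split; [exact Hd | apply Hu]]]. }
  exists x; split; [|exact Hx'].
  apply NNPP; intros Hn.
  destruct (compact_P2 K HK x Hn) as [d Hd].
  destruct (Hx' d 0%nat (cond_pos d)) as (m & t & _ & Ht & Hdt & _).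
  exact (Hd t Hdt Ht).
Qed.

Lemma angdist_lt (z xi : C) (rho : R) : Cmod z = 1 -> Cmod xi = 1 -> 0 < rho <= PI ->
  angdist z xi < rho <-> cos rho < Re (z * Cconj xi)%C.
Proof.
  intros Hz Hxi Hrho; unfold angdist; set (u := Re (z * Cconj xi)%C).
  assert (Hu : -1 <= u <= 1).
  { apply Rabs_le_between; apply Rle_trans with (1 := re_le_Cmod _).
    rewrite Cmod_mult Cmod_conj Hz Hxi; lra. }
  assert (Hb := acos_bound u).
  rewrite -{2}(cos_acos u Hu); split; intros H.
  - apply cos_decreasing_1; lra.
  - apply cos_decreasing_0; lra.
Qed.

(** The neighbourhoods removed from the circle are open because, by
    [angdist_lt], they are given by strict inequalities between continuous
    functions. *)
Lemma compact_F0 (E : C -> Prop) (rho : R) :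
  (forall xi, E xi -> Cmod xi = 1) -> 0 < rho <= PI ->
  compact (fun t => - PI <= t <= PI /\ F0 E rho (cis t)).
Proof.
  intros HE Hrho.
  apply compact_P4 with (fun t => - PI <= t <= PI).
  - apply compact_P3.
  - intros t Ht.
    destruct (classic (- PI <= t <= PI)) as [Hin|Hout].
    + assert (Hnb : exists xi, E xi /\ angdist (cis t) xi < rho).
      { apply NNPP; intros Hno; apply Ht; split; [exact Hin|].
        split; [apply Cmod_cis|]; intros [_ H]; exact (Hno H). }
      destruct Hnb as (xi & Hxi & H).
      apply angdist_lt in H; [|apply Cmod_cis | now apply HE | exact Hrho].
      assert (Hd : 0 < Re (cis t * Cconj xi)%C - cos rho) by lra.
      exists (mkposreal _ Hd); intros s Hs; unfold disc in Hs; simpl in Hs.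
      intros [_ [_ Hno]]; apply Hno; split; [apply Cmod_cis|].
      exists xi; split; [exact Hxi|].
      apply angdist_lt; [apply Cmod_cis | now apply HE | exact Hrho |].
      assert (H1 := re_le_Cmod ((cis s - cis t) * Cconj xi)%C).
      rewrite Cmod_mult Cmod_conj (HE xi Hxi) Rmult_1_r in H1.
      assert (H2 := cis_lipschitz s t).
      assert (H3 : Re ((cis s - cis t) * Cconj xi)%C
                   = Re (cis s * Cconj xi)%C - Re (cis t * Cconj xi)%C)
        by (simpl; ring).
      rewrite H3 in H1; apply Rabs_le_between in H1; simpl in *; lra.
    + assert (Hd : exists d, 0 < d /\ (d <= - PI - t \/ d <= t - PI)).
      { destruct (Rlt_dec t (- PI)) as [H|H]; [exists (- PI - t) | exists (t - PI)];
          (split; [|auto using Rle_refl]); [lra|].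
        apply NNPP; intros Hno; apply Hout; lra. }
      destruct Hd as (d & Hd & Hdt).
      exists (mkposreal d Hd); intros s Hs; unfold disc in Hs; simpl in Hs.
      intros [Hs' _].
      apply Rabs_def2 in Hs; lra.
  - intros t [H _]; exact H.
Qed.

(** The maxima over [n <= N] increase with [N] and each point of [F0] is
    reached by one of them, so failure for every [N] would leave a cluster
    point that none of them reaches. The minimum is attained at a cluster
    point of a minimising sequence. *)
Lemma gap_exists (c : nat -> C) (q rho : R) :
  in_A11 c -> 0 < rho <= PI -> (exists eta, F0 (Ewq c q) rho eta) ->
  exists (N : nat) (g : R), (1 <= N)%nat /\ is_gap c q (F0 (Ewq c q) rho) N g /\ 0 < g.
Proof.
  intros Hc Hrho (eta & Heta).
  set (F := F0 (Ewq c q) rho) in *.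
  set (K := fun t => - PI <= t <= PI /\ F (cis t)).
  set (f := fun t k => Cmod (weval c (Cpow (cis t) k))).
  assert (HK : compact K) by (apply compact_F0; [intros xi [H _]; exact H | exact Hrho]).
  assert (HL := Lw_ge0 c Hc).
  assert (Hlip : forall n s t,
    runmax (f s) n <= runmax (f t) n + Lw c * INR (S n) * Rabs (s - t)).
  { intros n s t; apply runmax_close; intros k Hk; unfold f; rewrite !cis_pow.
    assert (H := weval_cis_lipschitz c (INR k * s) (INR k * t) Hc).
    rewrite -Rmult_minus_distr_l Rabs_mult (Rabs_pos_eq (INR k)) in H; [|apply pos_INR].
    apply Rabs_le_between in H.
    assert (Lw c * (INR k * Rabs (s - t)) <= Lw c * (INR (S n) * Rabs (s - t))).
    { apply Rmult_le_compat_l; [exact HL|].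
      apply Rmult_le_compat_r; [apply Rabs_pos | apply le_INR; lia]. }
    lra. }
  assert (Hmono : forall n m t, (n <= m)%nat -> runmax (f t) n <= runmax (f t) m).
  { intros n m t Hnm; induction Hnm as [|m Hm IH]; [lra|].
    apply Rle_trans with (1 := IH), Rmax_l. }
  assert (HFE : forall t, F (cis t) -> exists n, q < runmax (f t) n).
  { intros t [Ht Hno].
    destruct (not_Ewq c q (cis t) Ht) as (n & Hn & H).
    - intros HE; apply Hno; split; [exact Ht|]; exists (cis t); split; [exact HE|].
      unfold angdist; rewrite -Cmod2_conj Ht pow1 /= acos_1; lra.
    - exists (pred n); apply Rlt_le_trans with (1 := H).
      apply (runmax_is_max (f t)); exists n; split; [lia | reflexivity]. }
  (* Strict lower bounds on [runmax] persist on a neighbourhood. *)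
  assert (Hnear : forall n x m0, m0 < runmax (f x) n ->
    exists eps, 0 < eps /\ forall t, Rabs (t - x) < eps -> m0 < runmax (f t) n).
  { intros n x m0 Hm.
    assert (HC : 0 < Lw c * INR (S n) + 1).
    { assert (0 <= Lw c * INR (S n))
        by (apply Rmult_le_pos; [exact HL | apply pos_INR]).
      lra. }
    exists ((runmax (f x) n - m0) / (Lw c * INR (S n) + 1)); split.
    - apply Rdiv_lt_0_compat; lra.
    - intros t Ht; assert (H := Hlip n x t).
      rewrite Rabs_minus_sym in H.
      assert (Lw c * INR (S n) * Rabs (t - x) < runmax (f x) n - m0); [|lra].
      apply Rle_lt_trans with ((Lw c * INR (S n) + 1) * Rabs (t - x)).
      + assert (0 <= Rabs (t - x)) by apply Rabs_pos; lra.
      + apply Rlt_le_trans with ((Lw c * INR (S n) + 1) *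
          ((runmax (f x) n - m0) / (Lw c * INR (S n) + 1))).
        * now apply Rmult_lt_compat_l.
        * right; field; lra. }
  assert (HN : exists n, forall t, K t -> q < runmax (f t) n).
  { apply NNPP; intros Hno.
    destruct (cluster_point K (fun n t => runmax (f t) n <= q) HK) as (x & Hx & Hcl).
    - intros n; apply NNPP; intros Hn; apply Hno; exists n; intros t Ht.
      apply Rnot_le_lt; intros Hle; apply Hn; now exists t.
    - destruct (HFE x (proj2 Hx)) as (n & Hn).
      destruct (Hnear n x q Hn) as (eps & Heps & He).
      destruct (Hcl eps n Heps) as (m & t & Hm & _ & Ht & Hle).
      assert (H1 := He t Ht); assert (H2 := Hmono n m t Hm); lra. }
  destruct HN as (n & Hn).
  destruct (circle_cis eta (proj1 Heta)) as (t1 & Ht1 & Et1).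
  assert (HKt1 : K t1) by (split; [exact Ht1 | rewrite -Et1; exact Heta]).
  set (I := Glb_Rbar (fun r => exists t, K t /\ r = runmax (f t) n)).
  assert (HI := Glb_Rbar_correct (fun r => exists t, K t /\ r = runmax (f t) n)).
  fold I in HI; destruct HI as [HI1 HI2].
  assert (HIq : Rbar_le q I).
  { apply HI2; intros r (t & Ht & ->); left; now apply Hn. }
  assert (HIt : Rbar_le I (runmax (f t1) n)) by (apply HI1; now exists t1).
  destruct I as [I| |]; try easy.
  destruct (cluster_point K (fun k t => runmax (f t) n < I + / (INR k + 1)) HK)
    as (x & Hx & Hcl).
  { intros k; apply NNPP; intros Hno.
    assert (Hk : 0 < / (INR k + 1))
      by (apply Rinv_0_lt_compat; assert (0 <= INR k) by apply pos_INR; lra).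
    assert (HH : Rbar_le (I + / (INR k + 1)) I); [|simpl in HH; lra].
    apply HI2; intros r (t & Ht & ->); apply Rnot_lt_le; intros Hlt; apply Hno.
    now exists t. }
  assert (HxI : runmax (f x) n <= I).
  { apply Rnot_lt_le; intros Hlt.
    set (m0 := (I + runmax (f x) n) / 2).
    destruct (Hnear n x m0) as (eps & Heps & He); [unfold m0; lra|].
    destruct (nfloor_ex (/ (m0 - I))) as [k Hk].
    { left; apply Rinv_0_lt_compat; unfold m0; lra. }
    destruct (Hcl eps k Heps) as (m & t & Hm & _ & Ht & Hlt').
    assert (H1 := He t Ht).
    assert (H2 : / (INR m + 1) <= m0 - I).
    { rewrite -(Rinv_inv (m0 - I)); apply Rinv_le_contravar.
      - apply Rinv_0_lt_compat; unfold m0; lra.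
      - apply le_INR in Hm; lra. }
    lra. }
  exists (S n), (I - q); split; [lia | split].
  - unfold is_gap; replace (I - q + q) with (runmax (f x) n).
    + split.
      * exists (cis x); split; [apply Hx|]; apply (runmax_is_max (f x)).
      * intros r (z & Hz & Hr).
        destruct (circle_cis z (proj1 Hz)) as (t & Ht & ->).
        assert (E : r = runmax (f t) n).
        { destruct (runmax_is_max (f t) n) as [G1 G2].
          apply Rle_antisym; [apply G2, Hr | apply Hr, G1]. }
        rewrite E; apply Rle_trans with (1 := HxI).
        apply HI1; exists t; split; [split; [exact Ht | exact Hz] | reflexivity].
    + assert (H : Rbar_le I (runmax (f x) n)) by (apply HI1; now exists x).
      simpl in H; lra.
  - assert (H := Hn x Hx); lra.
Qed.

(** * The bound on [K_E] *)

Lemma dist_set_bounds (E : C -> Prop) (z xi : C) : E xi ->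
  exists d : R, dist_set z E = Finite d /\ 0 <= d <= Cmod (z - xi)%C.
Proof.
  intros Hxi; unfold dist_set.
  destruct (Glb_Rbar_correct (fun r => exists xi, E xi /\ r = Cmod (z - xi)%C))
    as [H1 H2].
  assert (H3 : Rbar_le (Glb_Rbar (fun r => exists xi, E xi /\ r = Cmod (z - xi)%C))
                 (Cmod (z - xi)%C)) by (apply H1; now exists xi).
  assert (H4 : Rbar_le 0 (Glb_Rbar (fun r => exists xi, E xi /\ r = Cmod (z - xi)%C))).
  { apply H2; intros r (xi' & _ & ->); apply Cmod_ge_0. }
  destruct (Glb_Rbar _) as [d| |]; try easy.
  exists d; split; [reflexivity | split; [exact H4 | exact H3]].
Qed.

Lemma resolvent_norm_bounds {V : CompleteNormedModule C_AbsRing} (T : V -> V)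
  (z : C) (S : V -> V) (m : R) :
  is_resolvent T z S -> 0 <= m -> (forall x, norm (S x) <= m * norm x) ->
  exists r : R, resolvent_norm T z = Finite r /\ 0 <= r <= m.
Proof.
  intros HS Hm Hb; unfold resolvent_norm.
  destruct (proj2_sig (Rbar_ex_glb
    (fun r => exists S, is_resolvent T z S /\ r = opnorm S))) as [H1 H2].
  fold (Rbar_glb (fun r => exists S, is_resolvent T z S /\ r = opnorm S)) in H1, H2.
  assert (H3 := Rbar_le_trans _ _ _
    (H1 (opnorm S) (ex_intro _ S (conj HS eq_refl))) (opnorm_le S m Hm Hb)).
  assert (H4 : Rbar_le 0 (Rbar_glb (fun r => exists S, is_resolvent T z S /\ r = opnorm S))).
  { apply H2; intros r (S' & HS' & ->); apply opnorm_ge0, HS'. }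
  destruct (Rbar_glb _) as [r| |]; try easy.
  exists r; split; [reflexivity | split; [exact H4 | exact H3]].
Qed.

(** From the circle to the exterior: at [z = rho * eta] the resolvent is at
    most [M / (rho - 1)], which pays for the distance from [z] to [eta], while
    [(eta - T) (z - T)^-1 = 1 + (eta - z) (z - T)^-1] has norm at most [1 + M]. *)
Lemma KE_le_of_circle_bound {V : CompleteNormedModule C_AbsRing} (T : V -> V)
  (E : C -> Prop) (M K : R) :
  is_linear T -> (forall n y, norm (oppow T n y) <= M * norm y) -> 0 <= M ->
  0 <= K ->
  (forall eta, Cmod eta = 1 -> exists xi, E xi /\ forall x,
     Cmod (eta - xi)%C * norm x
       <= K * norm (minus (T x) (scal (eta : C_AbsRing) x))) ->
  Rbar_le (KE E T) (M + (1 + M) * K).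
Proof.
  intros HT HM HM0 HK H; unfold KE.
  apply (proj2_sig (Rbar_ex_lub (fun r => exists z, 1 < Cmod z /\
    r = Rbar_mult (dist_set z E) (resolvent_norm T z)))).
  intros r (z & Hz & ->).
  destruct (resolvent_exists T M z HT HM HM0 Hz) as (S & HS & HSn).
  set (rho := Cmod z) in *.
  set (eta := (z / RtoC rho)%C).
  assert (Hrho : RtoC rho <> 0%C) by (intros E0; apply RtoC_inj in E0; lra).
  assert (Heta : Cmod eta = 1).
  { unfold eta; rewrite Cmod_div // Cmod_R Rabs_pos_eq; fold rho; [field|]; lra. }
  assert (Hze : Cmod (z - eta)%C = rho - 1).
  { replace (z - eta)%C with (RtoC (rho - 1) * eta)%C.
    - rewrite Cmod_mult Heta Cmod_R Rabs_pos_eq; lra.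
    - unfold eta; rewrite RtoC_minus; field; exact Hrho. }
  destruct (H eta Heta) as (xi & Hxi & Hx).
  destruct (dist_set_bounds E z xi Hxi) as (d & -> & Hd0 & Hd).
  assert (HA : forall x, norm (minus (T (S x)) (scal (eta : C_AbsRing) (S x)))
                         <= (1 + M) * norm x).
  { intros x; set (y := S x).
    set (Ay := minus (T y) (scal (eta : C_AbsRing) y)).
    assert (E1 : Ay = minus (scal ((z - eta)%C : C_AbsRing) y) x).
    { rewrite -(proj2 (proj2 HS) x); fold y.
      assert (E2 : scal ((z - eta)%C : C_AbsRing) y
                   = minus (scal (z : C_AbsRing) y) (scal (eta : C_AbsRing) y))
        by exact (scal_minus_distr_r (z : C_AbsRing) (eta : C_AbsRing) y).
      rewrite E2; exact (eq_sym (minus_minus_minus _ _ _)). }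
    rewrite E1; apply Rle_trans with (1 := norm_triangle (V := V) _ _).
    rewrite (norm_opp (V := V)) (norm_scal_C_eq (W := V)) Hze.
    assert (Hy : (rho - 1) * norm y <= (rho - 1) * (M / (rho - 1) * norm x))
      by (apply Rmult_le_compat_l; [lra | apply HSn]).
    replace ((rho - 1) * (M / (rho - 1) * norm x)) with (M * norm x) in Hy
      by (field; lra).
    lra. }
  assert (HSn' : forall x, Cmod (z - xi)%C * norm (S x) <= (M + (1 + M) * K) * norm x).
  { intros x.
    assert (H1 : Cmod (z - xi)%C <= (rho - 1) + Cmod (eta - xi)%C).
    { rewrite -Hze; replace (z - xi)%C with ((z - eta) + (eta - xi))%C by ring.
      apply Cmod_triangle. }
    assert (H2 := Rle_trans _ _ _ (Hx (S x)) (Rmult_le_compat_l K _ _ HK (HA x))).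
    assert (H3 : 0 <= norm (S x)) by exact (norm_ge_0 (V := V) _).
    assert (H4 : (rho - 1) * norm (S x) <= M * norm x).
    { replace (M * norm x) with ((rho - 1) * (M / (rho - 1) * norm x)) by (field; lra).
      apply Rmult_le_compat_l; [lra | apply HSn]. }
    apply (Rmult_le_compat_r _ _ _ H3) in H1; lra. }
  set (B := M + (1 + M) * K) in *.
  assert (HB : 0 <= B)
    by (unfold B; assert (0 <= (1 + M) * K) by (apply Rmult_le_pos; lra); lra).
  destruct (Rle_lt_or_eq_dec 0 d Hd0) as [Hd1|Hd1].
  - destruct (resolvent_norm_bounds T z S (B / d) HS) as (r & -> & Hr).
    + apply Rdiv_le_0_compat; lra.
    + intros x; specialize (HSn' x).
      assert (0 <= norm (S x)) by exact (norm_ge_0 (V := V) _).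
      apply Rmult_le_reg_l with d; [exact Hd1|].
      replace (d * (B / d * norm x)) with (B * norm x) by (field; lra).
      apply Rle_trans with (2 := HSn').
      apply Rmult_le_compat_r; lra.
    + simpl; apply Rle_trans with (d * (B / d)); [apply Rmult_le_compat_l; lra|].
      right; field; lra.
  (* [z] at distance [0] from [E]: only finiteness of the norm matters. *)
  - destruct (resolvent_norm_bounds T z S (M / (rho - 1)) HS) as (r & -> & Hr);
      [apply Rdiv_le_0_compat; lra | exact HSn |].
    rewrite -Hd1 /=; lra.
Qed.

(** Close to a point [xi] of [E], of order [d], the powers of [eta ^ d] walk
    away from [1] in steps of [d] times the angle [th] between [eta] and [xi].
    These steps are too short to miss the arc, so that some power
    [eta ^ m] with [m * th <= 2 * PI] lies on it. *)
Lemma lower_bound_near_E {V : CompleteNormedModule C_AbsRing} (c : nat -> C)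
  (T : V -> V) (M q t0 l a D : R) (eta xi : C) (d : nat) (x : V) :
  in_A11 c -> is_linear T -> 0 <= M ->
  (forall n y, norm (oppow T n y) <= M * norm y) ->
  (forall n, (1 <= n)%nat -> Rbar_le (opnorm (wop c (oppow T n))) q) ->
  0 < l <= 2 * PI -> q < a ->
  (forall eta, arc t0 l eta -> a <= Cmod (weval c eta)) ->
  Cmod eta = 1 -> Cmod xi = 1 -> (1 <= d)%nat -> INR d <= D ->
  Cpow xi d = RtoC 1 -> angdist eta xi < l / (2 * D) ->
  Cmod (eta - xi)%C * norm x
    <= 2 * PI / (a - q) * (M * Lw c)
       * norm (minus (T x) (scal (eta : C_AbsRing) x)).
Proof.
  intros Hc HT HM0 HM Hq Hl Ha Harc Heta Hxi Hd HdD Hxid Hang.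
  set (A := norm (minus (T x) (scal (eta : C_AbsRing) x))).
  set (u := (eta * Cconj xi)%C).
  set (th := angdist eta xi) in *.
  assert (HL := Lw_ge0 c Hc); assert (HPI := PI_RGT_0).
  assert (HA : 0 <= A) by exact (norm_ge_0 (V := V) _).
  assert (Hx : 0 <= norm x) by exact (norm_ge_0 (V := V) _).
  assert (Hd1 : 1 <= INR d) by (apply (le_INR 1); exact Hd).
  assert (Hu : Cmod u = 1) by (unfold u; rewrite Cmod_mult Cmod_conj Heta Hxi; ring).
  destruct (circle_polar u Hu) as (sg & Hsg & Eu).
  change (acos (Re u)) with th in Eu.
  assert (Hth0 : 0 <= th) by (apply acos_bound).
  assert (Exi : (xi * Cconj xi)%C = RtoC 1) by (rewrite -Cmod2_conj Hxi pow1 //).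
  assert (Eeta : eta = (xi * u)%C).
  { unfold u; rewrite Cmult_assoc (Cmult_comm xi) -Cmult_assoc Exi; ring. }
  assert (Hdist : Cmod (eta - xi)%C <= th).
  { rewrite {1}Eeta; replace (xi * u - xi)%C with (xi * (u - 1))%C by ring.
    rewrite Cmod_mult Hxi Rmult_1_l Eu.
    apply Rle_trans with (1 := cis_sub_1_le _).
    rewrite Rabs_mult (Rabs_pos_eq th) //.
    destruct Hsg as [-> | ->]; rewrite ?Rabs_R1 ?Rabs_Ropp ?Rabs_R1; 
     rewrite ?(Rabs_left (-1)); lra. }
  assert (HK : 0 <= 2 * PI / (a - q)) by (apply Rdiv_le_0_compat; lra).
  apply Rle_trans with (th * norm x); [now apply Rmult_le_compat_r|].
  destruct Hth0 as [Hth|<-].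
  - assert (Hs : 0 < INR d * th <= l / 2).
    { split; [apply Rmult_lt_0_compat; lra|].
      apply Rle_trans with (D * (l / (2 * D))); [|right; field; lra].
      apply Rmult_le_compat; lra. }
    assert (Ed : Cpow eta d = cis (sg * (INR d * th))).
    { rewrite Eeta Cpow_mult_l Hxid Cmult_1_l Eu cis_pow; f_equal; ring. }
    destruct (power_hits_arc t0 l _ sg _ Hl Hs Hsg Ed) as (n & Hn & Hn2 & Hhit).
    apply Harc in Hhit; rewrite -Cpow_mult_r in Hhit.
    assert (H := lower_bound_of_wop c T M q eta (d * n) x Hc HT HM0 HM
                   (Hq (d * n)%nat ltac:(nia)) Heta).
    fold A in H; rewrite mult_INR in H.
    apply Rmult_le_reg_l with (a - q); [lra|].
    replace ((a - q) * (2 * PI / (a - q) * (M * Lw c) * A))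
      with (2 * PI * (M * Lw c * A)) by (field; lra).
    apply Rle_trans with (th * (INR d * INR n * (M * Lw c * A))).
    + replace ((a - q) * (th * norm x)) with (th * ((a - q) * norm x)) by ring.
      apply Rmult_le_compat_l; [lra|].
      apply Rle_trans with ((Cmod (weval c (Cpow eta (d * n))) - q) * norm x).
      * apply Rmult_le_compat_r; lra.
      * lra.
    + replace (th * (INR d * INR n * (M * Lw c * A)))
        with (INR n * (INR d * th) * (M * Lw c * A)) by ring.
      apply Rmult_le_compat_r; [|exact Hn2].
      apply Rmult_le_pos; [apply Rmult_le_pos|]; assumption.
  - rewrite Rmult_0_l.
    apply Rmult_le_pos; [apply Rmult_le_pos; [|apply Rmult_le_pos]|]; assumption.
Qed.

Theorem theorem4p11 (V : CompleteNormedModule C_AbsRing) (T : V -> V)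
  (HT : is_linear T) (HTpb : power_bounded T)
  (c : nat -> C) (Hc : in_A11 c) (q : R)
  (HwT : Rbar_le (Sup_seq (fun n => opnorm (wop c (oppow T (S n))))) q)
  (Hq : Rbar_lt q (wsup c)) :
  let E := Ewq c q in
  let M := real (power_sup T) in
  finite_set E /\
  (forall xi, E xi -> exists n, has_order xi n) /\
  ((exists xi, E xi) ->
   forall D : R, is_max_order E D ->
   forall t0 l a : R, 0 < l <= 2 * PI -> q < a ->
   (forall eta, arc t0 l eta -> a <= Cmod (weval c eta)) ->
   let F := F0 E (l / (2 * D)) in
   ((exists eta, F eta) ->
      (exists (N : nat) (g : R), (1 <= N)%nat /\ is_gap c q F N g /\ 0 < g) /\
      (forall (N : nat) (g : R), (1 <= N)%nat -> is_gap c q F N g -> 0 < g ->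
         Rbar_le (KE E T)
           (M + (1 + M) * M * Lw c * Rmax (2 * PI / (a - q)) (2 * INR N / g)))) /\
   (~ (exists eta, F eta) ->
      Rbar_le (KE E T) (M + (1 + M) * M * Lw c * (2 * PI / (a - q))))).
Proof.
  intros E M.
  destruct (Ewq_order_bound c q Hc Hq) as [m Hm].
  assert (Hord : forall xi, E xi -> exists n, has_order xi n).
  { intros xi Hxi; destruct (Hm xi Hxi) as (d & Hd & Ed).
    apply (has_order_exists xi d); [lia | exact Ed]. }
  split; [|split; [exact Hord|]].
  { destruct (finite_roots_of_unity m) as [s Hs]; exists s.
    intros z Hz; apply Hs; split; [apply Hz | now apply Hm]. }
  intros [xi0 Hxi0] D [_ HD] t0 l a Hl Ha Harc F.
  destruct (power_sup_finite T HT HTpb) as [HM0 HM]; fold M in HM0, HM.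
  assert (HL := Lw_ge0 c Hc); assert (HPI := PI_RGT_0).
  assert (Hwn : forall n, (1 <= n)%nat -> Rbar_le (opnorm (wop c (oppow T n))) q).
  { intros [|n] Hn; [lia|].
    exact (Rbar_le_trans _ _ _
      (Sup_seq_ub (fun n => opnorm (wop c (oppow T (S n)))) n) HwT). }
  assert (HD1 : 1 <= D).
  { destruct (Hord xi0 Hxi0) as [n Hn].
    apply Rle_trans with (INR n); [apply (le_INR 1), Hn|].
    apply HD; exists xi0, n; now split. }
  assert (Hrho : 0 < l / (2 * D) <= PI).
  { split; [apply Rdiv_lt_0_compat; lra|].
    apply Rmult_le_reg_r with (2 * D); [lra|].
    replace (l / (2 * D) * (2 * D)) with l by (field; lra); nra. }
  assert (Hpos : 0 <= 2 * PI / (a - q)) by (apply Rdiv_le_0_compat; lra).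
  assert (HML : 0 <= M * Lw c) by now apply Rmult_le_pos.
  assert (Hnear : forall eta, Cmod eta = 1 -> ~ F eta ->
    exists xi, E xi /\ forall x, Cmod (eta - xi)%C * norm x
      <= 2 * PI / (a - q) * (M * Lw c)
         * norm (minus (T x) (scal (eta : C_AbsRing) x))).
  { intros eta Heta HF.
    assert (Hxi : ang_nbhd E (l / (2 * D)) eta)
      by (apply NNPP; intros Hno; apply HF; now split).
    destruct Hxi as (_ & xi & Hxi & Hang); exists xi; split; [exact Hxi|].
    destruct (Hord xi Hxi) as (d & Hd); intros x.
    apply (lower_bound_near_E c T M q t0 l a D eta xi d x); auto; try apply Hxi; try apply Hd.
    apply HD; exists xi, d; now split. }
  assert (HKE : forall K, 2 * PI / (a - q) <= K ->
    (forall eta, F eta -> forall x, 2 * norm x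
       <= K * (M * Lw c) * norm (minus (T x) (scal (eta : C_AbsRing) x))) ->
    Rbar_le (KE E T) (M + (1 + M) * M * Lw c * K)).
  { intros K HK HF.
    replace ((1 + M) * M * Lw c * K) with ((1 + M) * (K * (M * Lw c))) by ring.
    apply KE_le_of_circle_bound; auto; [apply Rmult_le_pos; lra|].
    intros eta Heta; destruct (classic (F eta)) as [Hin|Hout].
    (* On the circle [2] bounds the distance to any point of [E]. *)
    - exists xi0; split; [exact Hxi0|]; intros x.
      apply Rle_trans with (2 := HF eta Hin x).
      apply Rmult_le_compat_r; [exact (norm_ge_0 (V := V) x)|].
      apply Rle_trans with (1 := Cmod_triangle eta (- xi0)%C).
      rewrite Cmod_opp Heta (proj1 Hxi0); lra.
    - destruct (Hnear eta Heta Hout) as (xi & Hxi & Hx); exists xi; split; [exact Hxi|].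
      intros x; apply Rle_trans with (1 := Hx x).
      apply Rmult_le_compat_r; [exact (norm_ge_0 (V := V) _)|].
      now apply Rmult_le_compat_r. }
  split.
  - intros HFne; split; [now apply gap_exists|].
    intros N g HN [_ Hgap] Hg.
    apply HKE; [apply Rmax_l|].
    intros eta HF x.
    set (A := norm (minus (T x) (scal (eta : C_AbsRing) x))).
    assert (HA : 0 <= A) by exact (norm_ge_0 (V := V) _).
    assert (Hx : 0 <= norm x) by exact (norm_ge_0 (V := V) _).
    destruct N as [|N]; [lia|].
    assert (Hmax := runmax_is_max (fun k => Cmod (weval c (Cpow eta k))) N).
    assert (H1 := Hgap _ (ex_intro _ eta (conj HF Hmax))).
    destruct Hmax as [(n & Hn & En) _]; rewrite En in H1.
    assert (H2 : (Cmod (weval c (Cpow eta n)) - q) * norm x <= INR n * M * Lw c * A)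
      by exact (lower_bound_of_wop c T M q eta n x Hc HT HM0 HM
                   (Hwn n (proj1 Hn)) (proj1 HF)).
    apply Rle_trans with (2 * INR (S N) / g * (M * Lw c) * A).
    + apply Rmult_le_reg_l with g; [exact Hg|].
      replace (g * (2 * INR (S N) / g * (M * Lw c) * A))
        with (2 * (INR (S N) * (M * Lw c * A))) by (field; lra).
      assert (HMA : 0 <= M * Lw c * A) by now apply Rmult_le_pos.
      assert (Hn2 : INR n <= INR (S N)) by (apply le_INR; lia).
      assert (H3 : g * norm x <= (Cmod (weval c (Cpow eta n)) - q) * norm x)
        by (apply Rmult_le_compat_r; lra).
      assert (H4 := Rmult_le_compat_r _ _ _ HMA Hn2).
      assert (Htwice : forall u v, g * u <= v -> g * (2 * u) <= 2 * v) by (intros; lra).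
      apply Htwice, (Rle_trans _ _ _ H3), (Rle_trans _ _ _ H2).
      lra.
    + apply Rmult_le_compat_r; [exact HA|].
      apply Rmult_le_compat_r; [exact HML | apply Rmax_r].
  - intros HFe; apply HKE; [apply Rle_refl|].
    intros eta HF; exfalso; apply HFe; now exists eta.
Qed.
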